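(* Let $r\geq 2$ be an integer, $0<\epsilon<\frac{1}{e\,r!}$, $\alpha=\frac{1}{e\,r!}-\epsilon$, and $n_0=\max\left\{\frac{12}{\alpha^2}\log\left(\frac{6}{\alpha^2}\right), \frac{4r}{\alpha}\log\left(\frac{2r}{\alpha}\right)\right\}$. If $G$ is a graph on $n\geq n_0$ vertices with minimum degree $\delta(G)\geq (1-\epsilon)n$, then in every $r$-coloring of the edges of $G$ there exists either a $(1,l,n)$-absorbing tree partition with $l\geq n-\frac{2}{\alpha}\log n$ (i.e. a monochromatic spanning tree with at least $n-\frac{2}{\alpha}\log n$ leaves) or a $(k,l,n)$-absorbing tree partition with $2\leq k\leq r$ and $l\geq \alpha n/2$.
   Context: Graphs are finite and simple; $\log$ is the natural logarithm with base $e$. An $r$-coloring is an arbitrary assignment of colors from $[r]=\{1,\dots,r\}$ to the edges. In an edge-colored graph $G$, a $(k,l,n)$-absorbing tree partition is a collection of trees $T_1,\dots,T_k$ (subgraphs of $G$) together with a common leaf set $L$ of size $l$ such that, after possibly renaming the colors: (i) $\left|\bigcup_{i\in[k]}V(T_i)\right|=n$; (ii) all edges of $T_i$ have color $i$ for all $i\in[k]$ (so the trees have distinct colors); (iii) every vertex in $L$ is a leaf of $T_i$ for all $i\in[k]$; (iv) $V(T_i)\cap V(T_j)=L$ for all $i\neq j$. *)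

(* Defs.v *)
From mathcomp Require Import all_boot all_order all_algebra all_fingroup.
From mathcomp Require Import all_classical all_reals all_analysis.
Set Implicit Arguments.
Unset Strict Implicit.
Unset Printing Implicit Defensive.

Definition degree (T : finType) (e : rel T) (x : T) : nat :=
  #|[set y | e x y]%SET|.

(* The default value #|T| is only reached when T is empty, since every degree
   in an irreflexive graph is less than #|T|. *)
Definition min_degree (T : finType) (e : rel T) : nat :=
  \big[minn/#|T|]_(x : T) degree e x.

Record subgraph (T : finType) := Subgraph {
  verts : {set T};
  adj : rel T }.

Definition is_subgraph (T : finType) (e : rel T) (H : subgraph T) : Prop :=
  symmetric (adj H) /\
  forall x y, adj H x y -> [/\ e x y, x \in verts H & y \in verts H].

Definition connected_subgraph (T : finType) (H : subgraph T) : Prop :=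
  verts H != finset.set0 /\
  forall x y, x \in verts H -> y \in verts H -> connect (adj H) x y.

Definition acyclic (T : finType) (H : subgraph T) : Prop :=
  forall s : seq T, 2 < size s -> ~ ucycle (adj H) s.

Definition is_tree (T : finType) (H : subgraph T) : Prop :=
  connected_subgraph H /\ acyclic H.

Definition is_leaf (T : finType) (H : subgraph T) (x : T) : Prop :=
  x \in verts H /\ degree (adj H) x = 1.

(* A coloring is a total function on {set T}, of which only the values at the
   edges [set x; y] matter. Colors and trees are numbered from 0; the
   permutation s is the renaming of the colors. *)
Definition absorbing_tree_partition (T : finType) (e : rel T) (r : nat)
    (c : {set T} -> 'I_r) (k l n : nat) : Prop :=
  exists (t : 'I_k -> subgraph T) (L : {set T}) (s : {perm 'I_r}),
  [/\ forall i, is_subgraph e (t i) /\ is_tree (t i),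
      #|L| = l,
      #|(\bigcup_(i < k) verts (t i))%SET| = n,
      forall i x y, adj (t i) x y -> s (c [set x; y]%SET) = i :> nat &
      (forall x, x \in L -> forall i, is_leaf (t i) x) /\
      (forall i j, i != j -> (verts (t i) :&: verts (t j))%SET = L)].

(* Main.v *)
(** Take stars with centres [x_0, ..., x_{k-1}], edges of distinct colours
    [col_0, ..., col_{k-1}], and a common leaf set [L]. If some vertex has fewer
    than [alpha n] neighbours in [L] through the colours in use, it becomes a new
    centre: most of [L] is joined to it in unused colours, and the most frequent
    one gives the next star. The size of [L] divides by the number of unused
    colours at each step, and [sum 1/i! <= e] is what keeps
    [|L| >= n / (e r!)] until the process stops, when every vertex has at
    least [alpha n] neighbours in [L] through the colours in use.

    A subset [M] of [L] is then split among the trees, each vertex of [M] being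
    an inner vertex of a single tree, so that every vertex outside the stars can
    be hung below [M] and [L \ M] consists of common leaves. For [k = 1] a
    greedily chosen dominating set of size at most [log n / alpha + 1] serves as
    [M]; for [k >= 2] a random [M] works. *)

Require Import Defs.
From mathcomp Require Import all_boot all_order all_algebra all_fingroup.
From mathcomp Require Import all_classical all_reals all_analysis.
From mathcomp Require Import zify ring lra.
Import Order.TTheory GRing.Theory Num.Theory.

(** * Trees given by a root and a parent function *)

Section ParentTree.
Variables (T : finType) (V : {set T}) (x0 : T) (par : T -> T) (rk : T -> nat).
Hypothesis x0V : x0 \in V.
Hypothesis parV : forall u, u \in V -> u != x0 -> par u \in V.
Hypothesis rk_par : forall u, u \in V -> u != x0 -> (rk (par u) < rk u)%N.

Definition parent_adj : rel T := fun u v =>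
  [&& u \in V, v \in V & ((u != x0) && (v == par u)) || ((v != x0) && (u == par v))].

Definition parent_tree := Subgraph V parent_adj.

Lemma parent_adj_sym : symmetric parent_adj.
Proof. by move=> u v; rewrite /parent_adj andbCA orbC. Qed.

Lemma parent_adj_rk {u v} : parent_adj u v -> (rk v <= rk u)%N -> v = par u.
Proof.
case/and3P=> uV vV /orP[/andP[_ /eqP//]|/andP[vx /eqP uE]].
by have := rk_par _ vV vx; rewrite -uE ltnNge => /negbTE ->.
Qed.

Lemma parent_tree_is_tree : is_tree parent_tree.
Proof.
split; first split.
- by apply/set0Pn; exists x0.
- have cx u : u \in V -> connect parent_adj u x0.
    have [m] := ubnP (rk u); elim: m u => // m IHm u; rewrite ltnS => rkm uV.
    have [->|ux] := eqVneq u x0; first exact: connect0.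
    apply: (@connect_trans _ _ (par u)).
      by apply: connect1; rewrite /parent_adj uV parV //= ux eqxx.
    by apply: IHm (parV _ uV ux); apply: leq_trans (rk_par _ uV ux) rkm.
  move=> u v uV vV; apply: connect_trans (cx _ uV) _.
  by rewrite (sym_connect_sym parent_adj_sym) cx.
(* A vertex of maximal rank on a cycle would have two distinct neighbours of
   smaller rank, but its only such neighbour is its parent. *)
- move=> s sz2 /= cyc.
  have [y0 y0s] : exists y, y \in s by case: s sz2 {cyc} => // y ? _; exists y; rewrite mem_head.
  case: (arg_maxnP rk y0s) => m ms maxm.
  case: (rot_to ms) => i s' rs.
  have : ucycle parent_adj (m :: s') by rewrite -rs rot_ucycle.
  have sz' : (1 < size s')%N by move: sz2 (congr1 size rs); rewrite size_rot /= => + sE; rewrite sE.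
  have s's y : y \in s' -> y \in s by rewrite -(mem_rot i s) rs inE orbC => ->.
  case: s' sz' s's {rs cyc} => // a s'; case/lastP: s' => // s' b _ s's.
  rewrite /ucycle /= rcons_path last_rcons => /andP[/andP[am /andP[_ bm]]].
  rewrite mem_rcons => /and3P[_ nab _].
  have aE : a = par m by apply: (parent_adj_rk am); apply: maxm; apply: s's; rewrite mem_head.
  have bE : b = par m.
    apply: parent_adj_rk; first by rewrite parent_adj_sym.
    by apply: maxm; apply: s's; rewrite in_cons mem_rcons mem_head orbT.
  by rewrite aE bE mem_head in nab.
Qed.

Lemma parent_tree_leaf u : u \in V -> u != x0 ->
  (forall v, v \in V -> v != x0 -> par v != u) -> is_leaf parent_tree u.
Proof.
move=> uV ux nch; split=> //; rewrite /degree.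
suff -> : [set y | parent_adj u y]%SET = [set par u]%SET by rewrite cards1.
apply/setP=> y; rewrite !inE /parent_adj uV ux /=.
apply/idP/idP=> [/andP[yV /orP[//|/andP[yx /eqP uE]]]|/eqP ->].
  by have := nch _ yV yx; rewrite -uE eqxx.
by rewrite parV ?eqxx.
Qed.

End ParentTree.

(** * Absorbing tree partitions from parent functions *)

(** This provides the renaming of the colours. List the values of [f] first and the other elements
    of ['I_r] after them; the permutation sends each element to its position. *)
Lemma perm_extends_inj {r k : nat} (f : 'I_k -> 'I_r) : injective f ->
  exists s : {perm 'I_r}, forall i, s (f i) = i :> nat.
Proof.
move=> finj.
pose q := codom f ++ [seq j <- enum 'I_r | j \notin codom f].
have qu : uniq q.
  rewrite cat_uniq (map_inj_uniq finj) enum_uniq filter_uniq ?enum_uniq // andbT.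
  by apply/hasPn=> j; rewrite mem_filter => /andP[].
have memq j : j \in q.
  by rewrite mem_cat mem_filter mem_enum andbT orbN.
have sq : size q = r.
  by have /card_uniqP <- := qu; rewrite (eq_card (B := predT)) ?card_ord.
have idx j : (index j q < r)%N by rewrite -[X in (_ < X)%N]sq index_mem memq.
have sinj : injective (fun j => Ordinal (idx j)).
  by move=> a b [] /(congr1 (nth a q)); rewrite !nth_index.
exists (perm sinj) => i; rewrite permE /=.
by rewrite index_cat codom_f /= index_map // index_enum_ord.
Qed.

(* Every vertex outside [L] lies in exactly one tree, given by [own], while
   those of [L] lie in all of them, with a parent depending on the tree. *)
Lemma absorbing_of_parents {T : finType} {e : rel T} {r k : nat} {c : {set T} -> 'I_r}
    (L : {set T}) (x : 'I_k -> T) (col : 'I_k -> 'I_r)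
    (own : T -> 'I_k) (par : 'I_k -> T -> T) (rk : T -> nat) :
  symmetric e -> (0 < k)%N -> injective col ->
  (forall i, x i \notin L) -> (forall i, own (x i) = i) ->
  (forall i u, (u \in L) || (own u == i) -> u != x i ->
     [/\ par i u \notin L, own (par i u) = i, e u (par i u),
         c [set u; par i u]%SET = col i & (rk (par i u) < rk u)%N]) ->
  absorbing_tree_partition e c k #|L| #|T|.
Proof.
move=> esym k0 colinj xL ownx H.
have [s sE] := perm_extends_inj _ colinj.
pose V i := [set u | (u \in L) || (own u == i)]%SET.
have xV i : x i \in V i by rewrite inE ownx eqxx orbT.
have parV i u : u \in V i -> u != x i -> par i u \in V i.
  by rewrite !inE => /H{}H /H[_ -> _ _ _]; rewrite eqxx orbT.
have rkV i u : u \in V i -> u != x i -> (rk (par i u) < rk u)%N.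
  by rewrite !inE => /H{}H /H[].
exists (fun i => parent_tree _ (V i) (x i) (par i)), L, s; split=> //.
- move=> i; split; last exact: (parent_tree_is_tree _ _ _ _ rk (xV i) (parV i) (rkV i)).
  split=> [|u v /= uv]; first exact: parent_adj_sym.
  have /and3P[uV vV b] := uv; split=> //.
  case/orP: b => /andP[ne /eqP E].
    by rewrite E; move: uV; rewrite inE => /H[].
  by rewrite E esym; move: vV; rewrite inE => /H[].
- rewrite -cardsT; congr (#|pred_of_set _|); apply/setP=> u; rewrite [RHS]inE.
  by apply/bigcupP; exists (own u) => //=; rewrite inE eqxx orbT.
- move=> i u v /= /and3P[uV vV /orP[]] /andP[ne /eqP E].
    by rewrite E; move: uV; rewrite inE => /H/(_ ne)[_ _ _ -> _]; rewrite sE.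
  by rewrite E finset.setUC; move: vV; rewrite inE => /H/(_ ne)[_ _ _ -> _]; rewrite sE.
split=> [u uL i|i j ij /=].
  apply: (parent_tree_leaf _ _ _ _ (parV i)).
  - by rewrite inE uL.
  - by apply: contraNneq (xL i) => <-.
  - move=> v; rewrite inE => /H{}H /H[+ _ _ _ _]; apply: contraNneq => ->//.
apply/setP=> u; rewrite !inE; case: (u \in L) => //=.
by apply/negP=> /andP[/eqP ->]; rewrite (negbTE ij).
Qed.

(** * Random and greedy covering sets *)

(** A uniform [f] has independent uniform values, so all constraints on [N] hold with probability
    [(a / #|S|) ^ #|N|]; denominators are cleared to stay in [nat]. *)
Lemma card_ffun_restricted {T S : finType} {N : {set T}} {P : T -> pred S} {a : nat} :
  (forall y, y \in N -> #|P y| = a) ->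
  (#|[set f : {ffun T -> S} | [forall y in N, P y (f y)]]%SET| * #|S| ^ #|N| =
   a ^ #|N| * #|{ffun T -> S}|)%N.
Proof.
move=> Pa; pose F (y : T) : pred S := if y \in N then P y else predT.
rewrite [#|[set _ | _]%SET|](_ : _ = #|(family F : simpl_pred {ffun T -> S})|); last first.
  apply: eq_card => f; rewrite inE; apply/forallP/familyP => /= H y.
    by rewrite /F; case: ifP => // yN; have := H y; rewrite yN.
  by apply/implyP => yN; have := H y; rewrite /F yN.
rewrite card_family foldrE big_map big_enum /= card_ffun.
rewrite (bigID (mem N)) /= (eq_bigr (fun=> a)); last by move=> y yN; rewrite /F yN Pa.
rewrite [X in (_ * X * _)%N](eq_bigr (fun=> #|S|)); last first.
  by move=> y; rewrite /F => /negbTE ->.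
rewrite !prod_nat_const -mulnA -expnD; congr (_ * _ ^ _)%N.
rewrite -(cardC N) addnC; congr addn; exact: eq_card.
Qed.

(* Each vertex of [L] independently joins [M] with probability 1/4 and then gets
   a uniform index in [K]. By Markov's inequality [M] has more than half of [L]
   with probability less than 1/2, and by the union bound some [v] stays
   uncovered with probability at most 1/2. *)
Lemma random_cover {T K : finType} (L : {set T}) (cov : T -> T -> K -> bool) :
  (0 < #|K|)%N ->
  (forall v, let d := #|[set y in L | [exists i, cov v y i]]%SET| in
     (2 * #|T| * (4 * #|K| - 1) ^ d <= (4 * #|K|) ^ d)%N) ->
  exists (M : {set T}) (g : T -> K),
    [/\ M \subset L, (2 * #|M| <= #|L|)%N &
        forall v, exists y, (y \in M) && cov v y (g y)].
Proof.
move=> K0 Hd.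
pose S : finType := (K * 'I_4)%type.
pose Q := (4 * #|K|)%N.
have cS : #|S| = Q by rewrite card_prod card_ord mulnC.
have Q0 : (0 < Q)%N by rewrite /Q; lia.
pose F := {ffun T -> S}.
pose on (f : F) y := (f y).2 == ord0.
pose M (f : F) := [set y in L | on f y]%SET.
pose unc (f : F) v := [forall y, (y \in M f) ==> ~~ cov v y (f y).1].
have F0 : (0 < #|F|)%N by rewrite card_ffun cS expn_gt0 Q0.
pose big := [set f : F | (#|L| < 2 * #|M f|)%N]%SET.
pose bad := [set f : F | [exists v, unc f v]]%SET.
have cardbig : (2 * #|big| < #|F|)%N.
  have on_card y : (#|[set f : F | on f y]%SET| * 4 = #|F|)%N.
    have cP z : z \in [set y]%SET -> #|[pred p : S | p.2 == ord0]| = #|K|.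
      move=> _.
      rewrite (@eq_card _ _ (finset.setX [set: K]%SET [set (ord0 : 'I_4)]%SET)) => [|[a b]].
        by rewrite cardsX cards1 muln1 cardsT.
      by rewrite !inE.
    have := card_ffun_restricted cP; rewrite cards1 !expn1 cS.
    have -> : [set f : F | [forall z in [set y]%SET, [pred p | p.2 == ord0] (f z)]]%SET =
              [set f : F | on f y]%SET.
      apply/setP=> f; rewrite !inE; apply/forallP/idP => [/(_ y)|fy z].
        by rewrite inE eqxx.
      by apply/implyP; rewrite inE => /eqP ->.
    by rewrite /Q mulnA [RHS]mulnC => /eqP; rewrite eqn_pmul2r // => /eqP.
  have sumM : ((\sum_(f : F) #|M f|) * 4 = #|L| * #|F|)%N.
    under eq_bigr => f _ do rewrite -sum1_card.
    rewrite (exchange_big_dep (mem L)) /=; last by move=> f y _; rewrite inE => /andP[].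
    rewrite big_distrl /= -sum_nat_const; apply: eq_bigr => y yL.
    rewrite -(on_card y) sum1dep_card; congr (_ * _)%N; apply: eq_card => f.
    by rewrite !inE yL.
  (* Markov's inequality: on [big] the integer [2 * #|M f|] is at least [#|L| + 1], and this extra 1
     makes [cardbig] strict, even for empty [L]. *)
  have : (#|big| * #|L|.+1 <= \sum_(f : F) 2 * #|M f|)%N.
    rewrite -sum_nat_const (bigID (mem big) predT) /=.
    apply: leq_trans (leq_addr _ _); apply: leq_sum => f; by rewrite inE.
  rewrite -big_distrr /=; move: sumM; move: F0.
  move: (\sum_f _)%N #|L| #|F| #|big| => a l m b; nia.
have cardunc v : (2 * #|T| * #|[set f : F | unc f v]%SET| <= #|F|)%N.
  have /= := Hd v; set N := [set y in L | _]%SET; rewrite -/Q => HN.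
  have [k0 _] : exists k0 : K, true.
    by case/card_gt0P: K0 => k0 _; exists k0.
  (* One covering index [i y] per vertex of [N] is enough: if [v] is uncovered, then [f y] avoids
     the pair [(i y, ord0)], which leaves [Q - 1] of the [Q] values. *)
  pose i y := odflt k0 [pick i | cov v y i].
  have iP y : y \in N -> cov v y (i y).
    rewrite inE => /andP[_ /existsP[j cj]]; rewrite /i; case: pickP => //= no.
    by have := no j; rewrite cj.
  have : ([set f : F | unc f v] \subset
          [set f : F | [forall y in N, f y != (i y, ord0)]])%SET.
    apply/fintype.subsetP => f; rewrite !inE => /forallP U.
    apply/forallP=> y; apply/implyP => yN; apply/negP => /eqP fy.
    have := U y; rewrite inE /on fy /= iP // implybF.
    by move: yN; rewrite inE => /andP[->].
  move/subset_leq_card => leU.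
  have cP y : y \in N -> #|predC1 (i y, ord0 : 'I_4)| = (Q - 1)%N.
    by move=> _; rewrite cardC1 cS subn1.
  have := card_ffun_restricted cP; rewrite cS => HA.
  rewrite -(leq_pmul2r (m := Q ^ #|N|)) ?expn_gt0 ?Q0 //.
  apply: leq_trans (_ : 2 * #|T| * ((Q - 1) ^ #|N| * #|F|) <= _)%N.
    by rewrite -mulnA leq_mul2l -HA leq_mul2r leU !orbT.
  by rewrite mulnA [X in (_ <= X)%N]mulnC leq_mul2r HN orbT.
have card_bad : (2 * #|bad| <= #|F|)%N.
  have [T0|T0] := posnP #|T|.
    rewrite (_ : bad = finset.set0) ?cards0 //; apply/setP => f; rewrite !inE.
    by apply/existsP=> -[v _]; have := card0_eq T0 v; rewrite !inE.
  rewrite -(leq_pmul2l T0).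
  apply: (@leq_trans (\sum_(v : T) 2 * #|T| * #|[set f : F | unc f v]%SET|)%N); last first.
    by apply: leq_trans (leq_sum _ (fun v _ => cardunc v)) _; rewrite sum_nat_const.
  rewrite -big_distrr /= mulnCA mulnA leq_mul2l; apply/orP; right.
  apply: (@leq_trans #|\bigcup_(v : T) [set f : F | unc f v]|%SET); last first.
    elim/big_rec2: _ => [|v m B _ IH]; first by rewrite cards0.
    by apply: leq_trans (leq_card_setU _ _) _; rewrite leq_add2l.
  apply: subset_leq_card.
  apply/fintype.subsetP => f; rewrite inE => /existsP[v fv].
  by apply/bigcupP; exists v; rewrite ?inE.
have [f] : exists f, f \notin (big :|: bad)%SET.
  apply/existsP; apply: contraT; rewrite negb_exists => /forallP all_bad.
  have : (#|F| <= #|big :|: bad|)%N.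
    by rewrite -cardsT subset_leq_card //; apply/fintype.subsetP => f _;
       have := all_bad f; rewrite negbK.
  move/leq_trans => /(_ _ (leq_card_setU _ _)); move: cardbig card_bad; lia.
rewrite !inE => /norP[fM /existsPn fc].
exists (M f), (fun y => (f y).1); split; last 1 first.
- move=> v; have /forallPn[y] := fc v; rewrite negb_imply negbK => H.
  by exists y.
- by apply/fintype.subsetP => y; rewrite inE => /andP[].
- by rewrite leqNgt.
Qed.

Local Open Scope ring_scope.

(** Double counting of the pairs with [cov v y] gives a [y] in [L] that covers at least the fraction
    [a] of the vertices still uncovered; adding it to [M] multiplies their number by at most
    [1 - a]. *)
Lemma greedy_cover {R : realFieldType} {T : finType} (L U : {set T}) (cov : rel T) (a : R) :
  (0 < #|L|)%N -> a <= 1 ->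
  (forall v, v \in U -> a * #|L|%:R <= #|[set y in L | cov v y]%SET|%:R) ->
  forall t : nat, exists M : {set T}, [/\ M \subset L, (#|M| <= t)%N &
    #|[set v in U | [forall y in M, ~~ cov v y]]%SET|%:R <= #|U|%:R * (1 - a) ^+ t].
Proof.
move=> L0 a1 H; elim=> [|t [M [ML Mt IH]]].
  exists finset.set0; rewrite finset.sub0set cards0 expr0 mulr1; split=> //.
  rewrite ler_nat subset_leq_card //; apply/fintype.subsetP => v.
  by rewrite inE => /andP[].
set W := [set v in U | _]%SET in IH.
have [y yL yW] : exists2 y, y \in L & a * #|W|%:R <= #|[set v in W | cov v y]%SET|%:R.
  apply/exists_inP; apply: contraT => /exists_inPn no.
  have : \sum_(y in L) #|[set v in W | cov v y]%SET|%:R < \sum_(y in L) (a * #|W|%:R).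
    have [y0 y0L] := card_gt0P L0.
    rewrite (bigD1 y0) //= [ltRHS](bigD1 y0) //=; apply: ltr_leD.
      by rewrite ltNge no.
    by apply: ler_sum => y /andP[yL _]; rewrite ltW // ltNge no.
  rewrite sumr_const -natr_sum ltNge => /negP[].
  have -> : (\sum_(y in L) #|[set v in W | cov v y]%SET| =
             \sum_(v in W) #|[set y in L | cov v y]%SET|)%N.
    under eq_bigr => y _ do rewrite -sum1_card.
    rewrite (exchange_big_dep (mem W)) /=; last by move=> y v _; rewrite inE => /andP[].
    apply: eq_bigr => v vW; rewrite sum1dep_card; apply: eq_card => y.
    by rewrite !inE; move: vW; rewrite inE => ->.
  rewrite natr_sum; apply: le_trans (_ : \sum_(v in W) a * #|L|%:R <= _).
    by rewrite sumr_const -[leLHS]mulr_natr -[leRHS]mulr_natr mulrAC.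
  by apply: ler_sum => v; rewrite inE => /andP[vU _]; exact: H.
exists (y |: M)%SET; split.
- by rewrite finset.subUset finset.sub1set yL.
- by rewrite cardsU1; case: (y \in M) => //=; rewrite ?add0n ?add1n // ltnW.
- set W' := [set v in U | _]%SET.
  have -> : W' = (W :\: [set v in W | cov v y])%SET.
    apply/setP=> v; rewrite !inE.
    case: (v \in U); rewrite ?andbF //=.
    apply/forall_inP/idP => [all_yM|/andP[+ /forall_inP allM] z].
      rewrite (negbTE (all_yM y _)) ?finset.setU11 // andbF /=.
      by apply/forall_inP => z zM; apply: all_yM; rewrite setU1r.
    rewrite (introT forall_inP allM) /= => ncov.
    by case/setU1P => [->//|/allM].
  rewrite cardsD (finset.setIidPr _); last by apply/fintype.subsetP=> v; rewrite inE => /andP[].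
  rewrite natrB; last first.
    by rewrite subset_leq_card //; apply/fintype.subsetP=> v; rewrite inE => /andP[].
  rewrite exprSr mulrA; apply: le_trans (_ : (1 - a) * #|W|%:R <= _); first by lra.
  by rewrite mulrC ler_wpM2r // subr_ge0.
Qed.

(** * Integer weights and the exponential series *)

(** The number of sequences without repetition, of any length, in a set of [m] elements: the empty
    one, or a first entry followed by a sequence in the rest. *)
Fixpoint arrangements (m : nat) : nat :=
  if m is m'.+1 then (1 + m * arrangements m')%N else 1%N.

Lemma arrangements_gt0 m : (0 < arrangements m)%N.
Proof. by case: m. Qed.

Lemma arrangementsE {R : realFieldType} m :
  (arrangements m)%:R = (m`!)%:R * \sum_(0 <= i < m.+1) (i`!)%:R^-1 :> R.
Proof.
elim: m => [|m IH]; first by rewrite big_nat1 fact0 invr1 mulr1.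
rewrite big_nat_recr //= mulrDr mulfV ?pnatr_eq0 -?lt0n ?fact_gt0 //.
by rewrite factS !natrM -mulrA -IH natrD natrM addrC.
Qed.

Lemma arrangements_le_expR1 {R : realType} m :
  (arrangements m)%:R <= expR 1 * (m`!)%:R :> R.
Proof.
rewrite arrangementsE mulrC ler_wpM2r ?ler0n //.
have -> : \sum_(0 <= i < m.+1) (i`!)%:R^-1 = series (exp_coeff (1 : R)) m.+1.
  by rewrite /series /=; apply: eq_bigr => i _; rewrite exp_coeffE expr1n mulr1.
apply: nondecreasing_cvgn_le; last exact: is_cvg_series_exp_coeff.
by apply: nondecreasing_series => i _ _; exact: exp_coeff_ge0.
Qed.

(** * Growing systems of stars with common leaves *)

Section Stars.
Variables (R : realFieldType) (T : finType) (e : rel T) (r : nat) (c : {set T} -> 'I_r).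

Definition star_system {k} (x : 'I_k -> T) (col : 'I_k -> 'I_r) (L : {set T}) :=
  injective col /\
  forall i y, y \in L -> e (x i) y && (c [set x i; y]%SET == col i).

Definition usable_nbrs {k} (col : 'I_k -> 'I_r) (L : {set T}) (v : T) : {set T} :=
  [set y in L | e v y && [exists i, c [set v; y]%SET == col i]]%SET.

(** The new star gets index [ord0], where [unlift] returns [None]; every other index is sent back to
    its old star. *)
Lemma star_system_cons k (x : 'I_k -> T) col L v j (L' : {set T}) :
  star_system x col L -> j \notin codom col -> L' \subset L ->
  (forall y, y \in L' -> e v y && (c [set v; y]%SET == j)) ->
  star_system (fun i : 'I_k.+1 => oapp x v (unlift ord0 i))
              (fun i : 'I_k.+1 => oapp col j (unlift ord0 i)) L'.
Proof.
case=> colinj xL jcol /fintype.subsetP L'L vL'; split=> [i1 i2|i y yL'].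
  case: unliftP => [j1 ->|->]; case: unliftP => [j2 ->|->] //=.
  - by move/colinj => ->.
  - by move=> E; rewrite -E codom_f in jcol.
  - by move=> E; rewrite E codom_f in jcol.
by case: unliftP => [i' _|_] /=; [apply: xL; apply: L'L|exact: vL'].
Qed.

Definition fresh_nbrs {k} (col : 'I_k -> 'I_r) (L : {set T}) (v : T) : {set T} :=
  [set y in L | e v y && (c [set v; y]%SET \notin codom col)]%SET.

Lemma card_fresh_nbrs_gt (a b : R) k (col : 'I_k -> 'I_r) (L : {set T}) v :
  #|[set y | ~~ e v y]%SET|%:R <= b -> #|usable_nbrs col L v|%:R < a ->
  #|L|%:R - (a + b) < #|fresh_nbrs col L v|%:R.
Proof.
move=> Hb Ha.
have sub : L \subset (usable_nbrs col L v :|: [set y | ~~ e v y]) :|: fresh_nbrs col L v.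
  apply/fintype.subsetP => y yL; rewrite !inE yL /=.
  case: (e v y); rewrite ?orbT //= orbF; case: existsP => //= no.
  by apply/negP => /codomP[i Ei]; apply: no; exists i; rewrite Ei.
have : #|L|%:R <= (#|usable_nbrs col L v| + #|[set y | ~~ e v y]%SET|
                   + #|fresh_nbrs col L v|)%N%:R :> R.
  rewrite ler_nat; apply: leq_trans (subset_leq_card sub) _.
  apply: leq_trans (leq_card_setU _ _) _; rewrite leq_add2r; exact: leq_card_setU.
by rewrite !natrD; lra.
Qed.

(* The weights satisfy [arrangements m.+1 = 1 + m.+1 * arrangements m]: losing
   [a + b] vertices of [L] and keeping the most frequent of the [m.+1] unused
   colours turns the bound for [m.+1] unused colours into that for [m]. *)
Lemma star_system_saturate (a b : R) m k (x : 'I_k -> T) col L :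
  0 <= a -> 0 <= b -> (forall v, #|[set y | ~~ e v y]%SET|%:R <= b) ->
  (k + m)%N = r -> star_system x col L -> (a + b) * (arrangements m)%:R <= #|L|%:R ->
  exists k' (x' : 'I_k' -> T) (col' : 'I_k' -> 'I_r) (L' : {set T}),
    [/\ star_system x' col' L', a + b <= #|L'|%:R &
        forall v, a <= #|usable_nbrs col' L' v|%:R].
Proof.
move=> a0 b0 Hb.
have ab0 : 0 <= a + b by rewrite addr_ge0.
(* For every [m], a system without deficient vertex is already as required, since the weight
   [arrangements m] is at least 1. *)
elim: m k x col L => [|m IHm] k x col L km sys Lm;
  (have [/forallP good|/forallPn[v]] := boolP [forall v, a <= #|usable_nbrs col L v|%:R];
   [exists k, x, col, L; split=> //; apply: le_trans Lm;
    by rewrite ler_peMr // (ler_nat _ 1) arrangements_gt0|]);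
  rewrite -ltNge => va; have LL1 := card_fresh_nbrs_gt _ _ _ _ _ _ (Hb v) va;
  set L1 := fresh_nbrs _ _ _ in LL1.
- have : 0 < #|L1|%:R :> R by apply: le_lt_trans LL1; move: Lm; rewrite /= mulr1; lra.
  rewrite ltr0n => /card_gt0P[y]; rewrite inE => /and3P[_ _ /negP[]].
  by apply: (inj_card_onto sys.1); rewrite !card_ord -[X in (X <= _)%N]km addn0.
- pose unused := [set j | j \notin codom col]%SET.
  have [j jcol jL1] : exists2 j, j \in unused &
      (a + b) * (arrangements m)%:R <= #|[set y in L1 | c [set v; y]%SET == j]%SET|%:R.
    apply/exists_inP; apply: contraT => /exists_inPn no.
    have ncol : #|unused| = m.+1.
      rewrite cardsE; have := cardC [in codom col]; rewrite card_codom; last exact: sys.1.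
      by rewrite !card_ord -[X in _ = X]km => /addnI.
    have : #|L1|%:R <= \sum_(j in unused) ((a + b) * (arrangements m)%:R).
      apply: (@le_trans _ _ (\sum_(j in unused)
          #|[set y in L1 | c [set v; y]%SET == j]%SET|%:R)); last first.
        by apply: ler_sum => j jcol; rewrite ltW // ltNge no.
      rewrite -natr_sum ler_nat -sum1_card.
      rewrite (partition_big (fun y => c [set v; y]%SET) (mem unused)) /=.
        apply: leq_sum => j _; rewrite sum1dep_card; apply: eq_leq.
        by apply: eq_card => y; rewrite [LHS]inE [RHS]inE.
      by move=> y; rewrite !inE => /and3P[].
    rewrite sumr_const ncol -[leRHS]mulr_natr.
    move: Lm; rewrite /= natrD natrM; move: LL1; set N := (arrangements m)%:R.
    nra.
  rewrite inE in jcol.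
  apply: IHm (star_system_cons _ _ _ _ v j _ sys jcol _ _) jL1; first by rewrite addSnnS.
  + by apply/fintype.subsetP => y; rewrite !inE => /andP[/andP[]].
  + by move=> y; rewrite !inE => /andP[/and3P[_ -> _]].
Qed.

End Stars.

(** * Tree partitions from stars and a covering set *)

(** Take [x] as root and [M] as its children; every other vertex hangs below a vertex of [M] and is
    therefore a leaf. *)
Lemma dominating_set_partition {T : finType} {e : rel T} {r : nat} {c : {set T} -> 'I_r}
    (x : T) (M : {set T}) (j : 'I_r) :
  symmetric e -> irreflexive e ->
  (forall y, y \in M -> e x y && (c [set x; y]%SET == j)) ->
  (forall v, exists y, (y \in M) && (e v y && (c [set v; y]%SET == j))) ->
  absorbing_tree_partition e c 1 #|~: (x |: M)%SET| #|T|.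
Proof.
move=> esym eirr xM dom.
have [h hP] := choice dom.
have xnM : x \notin M by apply/negP => /xM; rewrite eirr.
apply: (absorbing_of_parents _ (fun=> x) (fun=> j) (fun=> ord0)
          (fun _ u => if u \in M then x else h u)
          (fun u => if u == x then 0 else if u \in M then 1 else 2)%N) => //.
- by move=> i1 i2 _; rewrite !ord1.
- by move=> _; rewrite !inE eqxx.
- by move=> i; rewrite [RHS]ord1.
move=> i u _ ux; rewrite (negbTE ux) [i]ord1; have [uM|uM] := boolP (u \in M).
  have /andP[exu /eqP cxu] := xM _ uM.
  by rewrite eqxx !inE eqxx esym finset.setUC.
have /and3P[hM eh /eqP ch] := hP u; rewrite hM !inE hM orbT.
by split=> //; case: eqP.
Qed.

Lemma star_system_partition {T : finType} {e : rel T} {r k : nat} {c : {set T} -> 'I_r}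
    (x : 'I_k -> T) (col : 'I_k -> 'I_r) (L M : {set T}) (g : T -> 'I_k) :
  symmetric e -> irreflexive e -> (0 < k)%N -> (0 < #|L|)%N ->
  star_system T e r c x col L -> M \subset L ->
  (forall v, exists y, (y \in M) && (e v y && (c [set v; y]%SET == col (g y)))) ->
  absorbing_tree_partition e c k #|L :\: M|%SET #|T|.
Proof.
move=> esym eirr k0 /card_gt0P[y0 y0L] [colinj xL] /fintype.subsetP ML dom.
have [h hP] := choice dom.
have xnL i : x i \notin L by apply/negP => /(xL i); rewrite eirr.
(* A vertex of the nonempty set [L] is joined to the centres in pairwise different colours, which
   separates the centres. *)
have xinj : injective x.
  move=> i1 i2 E; apply: colinj.
  have /andP[_ /eqP <-] := xL i1 _ y0L; have /andP[_ /eqP <-] := xL i2 _ y0L.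
  by rewrite E.
(* A centre belongs to its own star, a vertex [u] of [M] to the tree [g u], and any other vertex to
   the tree of the vertex [h u] of [M] below which it can hang. *)
pose own u := if [pick i | x i == u] is Some i then i
              else if u \in M then g u else g (h u).
have own_x i : own (x i) = i.
  by rewrite /own; case: pickP => [i' /eqP/xinj //|/(_ i)]; rewrite eqxx.
have own_L u : u \in L -> own u = if u \in M then g u else g (h u).
  by move=> uL; rewrite /own; case: pickP => // i /eqP E; rewrite -E (negbTE (xnL i)) in uL.
apply: (absorbing_of_parents _ x col own (fun i u => if u \in L then x i else h u)
   (fun u => if u \in L then 1 else if [exists i, x i == u] then 0 else 2)%N) => //.
  by move=> i; rewrite inE (negbTE (xnL i)) andbF.
move=> i u ui ux; have [uL|uL] := boolP (u \in L).
  have /andP[exu /eqP cxu] := xL i _ uL.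
  rewrite own_x inE (negbTE (xnL i)) andbF esym finset.setUC; split=> //.
  by rewrite ifT //; apply/existsP; exists i.
have {ui} : own u == i by move: ui; rewrite inE (negbTE uL) andbF.
have uM : u \notin M by apply: contra uL => /ML.
rewrite {1}/own; case: pickP => [i' /eqP xi' /eqP E|nox].
  by rewrite -xi' E eqxx in ux.
rewrite (negbTE uM) => /eqP gi.
have /and3P[hM eh /eqP ch] := hP u.
have hL := ML _ hM.
rewrite inE hM own_L // hM hL gi ch gi; split=> //.
by rewrite ifF //; apply/existsP => -[i' ]; rewrite nox.
Qed.

(** * Degrees and real estimates *)

Lemma min_degree_le {T : finType} (e : rel T) v : (min_degree e <= degree e v)%N.
Proof.
rewrite /min_degree; have := mem_index_enum v; move: (index_enum T) => s.
elim: s => // u s IH; rewrite in_cons big_cons => /orP[/eqP <-|/IH].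
  exact: geq_minl.
exact/leq_trans/geq_minr.
Qed.

Lemma card_nonnbrs {R : realFieldType} {T : finType} (e : rel T) (eps : R) v :
  (1 - eps) * #|T|%:R <= (min_degree e)%:R ->
  #|[set y | ~~ e v y]%SET|%:R <= eps * #|T|%:R.
Proof.
move=> H; have : (min_degree e)%:R <= (degree e v)%:R :> R by rewrite ler_nat min_degree_le.
have -> : [set y | ~~ e v y]%SET = (~: [set y | e v y])%SET by apply/setP=> y; rewrite !inE.
rewrite cardsCs finset.setCK natrB ?max_card // -/(degree e v); lra.
Qed.

Section RealEstimates.
Context {R : realType}.
Implicit Types x A a : R.

(* The tangent to [ln] at [2 * A] bounds [A * ln x] by
   [x / 2 + A * ln (2 * A) - A]. *)
Lemma le_mul_ln A x : 1 <= A -> 0 < x -> 2 * A * ln A <= x -> A * ln x <= x.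
Proof.
move=> A1 x0 H; have A0 : 0 < A by lra.
have ln_le_sub1 (y : R) : 0 < y -> ln y <= y - 1.
  by move=> y0; have := @le_ln1Dx R (y - 1); rewrite addrCA subrr addr0; apply; lra.
have h2 : ln 2 <= 1 :> R by have := ln_le_sub1 2 ltac:(lra); lra.
have hx : ln x = ln (x / (2 * A)) + (ln 2 + ln A).
  rewrite -!lnM ?posrE ?divr_gt0 ?mulr_gt0 //; congr ln; field; lra.
have ht : ln (x / (2 * A)) <= x / (2 * A) - 1 by apply: ln_le_sub1; rewrite divr_gt0 ?mulr_gt0.
have : A * ln x <= A * (x / (2 * A) - 1 + (1 + ln A)) by rewrite ler_pM2l //; lra.
have -> : A * (x / (2 * A) - 1 + (1 + ln A)) = x / 2 + A * ln A by field; lra.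
lra.
Qed.

Lemma exprn_1B_le_expR a (t : nat) : a <= 1 -> (1 - a) ^+ t <= expR (- (a * t%:R)).
Proof.
move=> a1; rewrite -mulNr expRM_natr lerXn2r ?nnegrE ?expR_ge0 ?subr_ge0 //.
by have := expR_ge1Dx (- a).
Qed.

(** Here [(1 - 1 / q) ^ d <= exp (- d / q) <= 1 / m]. With [q = 4 * k] and [m = 2 * n] this yields
    the hypothesis of [random_cover]. *)
Lemma pred_expn_le (q d m : nat) : (0 < q)%N -> (0 < m)%N -> ln m%:R <= d%:R / q%:R :> R ->
  (m * (q - 1) ^ d <= q ^ d)%N.
Proof.
move=> q0 m0 H; rewrite -(ler_nat R) natrM !natrX natrB //.
have q0' : 0 < q%:R :> R by rewrite ltr0n.
have -> : q%:R - 1 = q%:R * (1 - q%:R^-1) :> R by rewrite mulrBr mulr1 mulfV // gt_eqF.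
rewrite exprMn mulrCA ler_piMr ?exprn_ge0 ?ler0n //.
have q1 : q%:R^-1 <= 1 :> R by rewrite invf_le1 // ler1n.
have m0' : 0 < m%:R :> R by rewrite ltr0n.
rewrite -ler_pdivlMl // mulr1; apply: le_trans (exprn_1B_le_expR _ _ q1) _.
by rewrite -[m%:R]lnK ?posrE // -expRN ler_expR lerN2 mulrC.
Qed.

End RealEstimates.

(** * Choice of the constants and cases by the number of stars *)

Theorem theorem4p3 (R : realType) (r : nat) (eps alpha n0 : R)
  (hr : (2 <= r)%N)
  (heps0 : 0 < eps)
  (heps1 : eps < 1 / (expR 1 * (r`!)%:R))
  (halpha : alpha = 1 / (expR 1 * (r`!)%:R) - eps)
  (hn0 : n0 = Num.max (12 / alpha ^+ 2 * ln (6 / alpha ^+ 2))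
                      (4 * r%:R / alpha * ln (2 * r%:R / alpha)))
  (T : finType) (n : nat) (hT : #|T| = n) (hn : n0 <= n%:R)
  (e : rel T) (esym : symmetric e) (eirr : irreflexive e)
  (hdeg : (1 - eps) * n%:R <= (min_degree e)%:R)
  (c : {set T} -> 'I_r) :
  (exists l : nat, absorbing_tree_partition e c 1 l n /\
     n%:R - 2 / alpha * ln n%:R <= l%:R) \/
  (exists k l : nat, [/\ (2 <= k <= r)%N, absorbing_tree_partition e c k l n &
     alpha * n%:R / 2 <= l%:R]).
Proof.
have alpha0 : 0 < alpha by rewrite halpha subr_gt0.
have e2 : 2 <= expR 1 :> R by have := expR_ge1Dx (1 : R).
have rfact m : (m <= m`!)%N by case: m => // m; rewrite factS leq_pmulr ?fact_gt0.
have rR : 2 <= r%:R :> R by rewrite (ler_nat _ 2).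
have fR : r%:R <= (r`!)%:R :> R by rewrite ler_nat.
have er0 : 0 < expR 1 * (r`!)%:R :> R by rewrite mulr_gt0; lra.
have alpha_er : alpha * (expR 1 * (r`!)%:R) <= 1.
  by rewrite -ler_pdivlMr // halpha; lra.
(* The first term of [n0] is [2 * A * ln A], so [le_mul_ln] will give [A * ln n <= n], that is
   [6 / alpha * ln n <= alpha * n]. *)
pose A := 6 / alpha ^+ 2.
have Aalpha : A * alpha ^+ 2 = 6 by rewrite /A divfK // expf_neq0 ?gt_eqF.
have alphae : alpha * expR 1 <= 1 / 2.
  have : alpha * expR 1 * 2 <= alpha * expR 1 * (r`!)%:R.
    by rewrite ler_wpM2l ?mulr_ge0 ?expR_ge0 ?(ltW alpha0) //; lra.
  by have := alpha_er; rewrite mulrA; set z := alpha * expR 1; set w := z * _; lra.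
(* This will give [2 <= ln n], which absorbs the additive constants in the case of one star. *)
have A_e2 : expR 2 <= A.
  have -> : expR 2 = expR 1 ^+ 2 :> R by rewrite -expRM_natr mul1r.
  rewrite -(ler_pM2r (x := alpha ^+ 2)) ?exprn_gt0 // Aalpha -exprMn mulrC.
  have : 0 <= alpha * expR 1 by rewrite mulr_ge0 ?expR_ge0 ?(ltW alpha0).
  move: alphae; set z := alpha * _; nra.
have lnA : 2 <= ln A.
  by rewrite -ler_expR lnK // posrE; apply: lt_le_trans A_e2; exact: expR_gt0.
have A1 : 3 <= A by apply: le_trans A_e2; have := expR_ge1Dx (2 : R); lra.
have nA : 2 * A * ln A <= n%:R.
  apply: le_trans hn; rewrite hn0 le_max; apply/orP; left.
  by rewrite (_ : 2 * A = 12 / alpha ^+ 2) // /A; field; rewrite gt_eqF.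
have nA' : A <= n%:R by apply: le_trans nA; nra.
have nR0 : 0 < n%:R :> R by lra.
have lnn : 2 <= ln n%:R :> R.
  by apply: le_trans lnA _; rewrite ler_ln ?posrE //; lra.
have AlnN : A * ln n%:R <= n%:R :> R by apply: le_mul_ln; rewrite //; lra.
have v0 : T.
  by have : (0 < #|T|)%N; [rewrite hT -(ltr0n R)|case/card_gt0P/sigW].
pose a := alpha * n%:R; pose b := eps * n%:R.
have a0 : 0 < a by rewrite mulr_gt0.
have b0 : 0 < b by rewrite mulr_gt0.
have Hb v : #|[set y | ~~ e v y]%SET|%:R <= b.
  by rewrite /b -hT card_nonnbrs // hT.
(* Start with no star and all vertices as leaves; [v0] and [c finset.set0] are placeholders in
   functions on the empty type ['I_0]. *)
have sys0 : star_system T e r c (fun _ : 'I_0 => v0) (fun _ => c finset.set0) [set: T]%SET.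
  by split=> [[]|[]].
(* Here [a + b = n / (e r!)], and [arrangements r <= e r!]. *)
have L0 : (a + b) * (arrangements r)%:R <= #|[set: T]%SET|%:R.
  rewrite cardsT hT /a /b -mulrDl halpha subrK mulrAC ler_piMl ?ler0n //.
  by rewrite mul1r mulrC ler_pdivrMr // mul1r arrangements_le_expR1.
have [k [x [col [L [sys Lab usable]]]]] :=
  star_system_saturate R T e r c a b r 0 _ _ _ (ltW a0) (ltW b0) Hb (add0n r) sys0 L0.
have L_gt0 : (0 < #|L|)%N by rewrite -(ltr0n R); lra.
have kr : (k <= r)%N by have := leq_card col sys.1; rewrite !card_ord.
have aln : 6 / alpha * ln n%:R <= a.
  by rewrite /a -ler_pdivrMl // mulrA (_ : alpha^-1 * (6 / alpha) = A) // /A; field; rewrite gt_eqF.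
case: k x col sys Lab usable kr => [|[|k]] x col sys Lab usable kr.
(* Without stars no colour is in use, so [v0] has no usable neighbour, contrary to [0 < a]. *)
- have := lt_le_trans a0 (usable v0); rewrite ltr0n => /card_gt0P[y].
  by rewrite inE => /and3P[_ _ /existsP[[]]].
- left.
  pose cov v y := e v y && (c [set v; y]%SET == col ord0).
  (* As [t > ln n / alpha], the number [n * (1 - alpha) ^ t <= n * exp (- alpha * t)] is below 1, so
     at most [t] vertices dominate everything. *)
  pose t := (Num.trunc (ln n%:R / alpha)).+1.
  have al1 : alpha <= 1 by nra.
  have lna0 : 0 <= ln n%:R / alpha by rewrite divr_ge0 //; lra.
  have /andP[thi tlo] := truncn_itv lna0; rewrite -/t in tlo.
  have Hcov v : v \in [set: T]%SET -> alpha * #|L|%:R <= #|[set y in L | cov v y]%SET|%:R.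
    move=> _; apply: le_trans (_ : a <= _).
      by rewrite /a ler_wpM2l ?(ltW alpha0) // ler_nat -hT max_card.
    apply: le_trans (usable v) _; rewrite ler_nat; apply: subset_leq_card.
    apply/fintype.subsetP => y; rewrite !inE /cov => /and3P[-> -> /existsP[i]].
    by rewrite [i]ord1.
  have [M [ML Mt]] := greedy_cover L [set: T]%SET cov alpha L_gt0 al1 Hcov t.
  set unc := #|_|%:R => Hunc.
  have unc1 : unc < 1.
    apply: le_lt_trans Hunc _; rewrite cardsT hT -ltr_pdivlMl // mulr1.
    apply: le_lt_trans (exprn_1B_le_expR _ _ al1) _.
    rewrite -[X in X^-1]lnK ?posrE // -expRN ltr_expR ltrN2.
    by move: tlo; rewrite ltr_pdivrMr // mulrC.
  exists #|~: (x ord0 |: M)%SET|; split.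
    rewrite -hT; apply: (dominating_set_partition _ _ (col ord0)) => //.
    + by move=> y /(fintype.subsetP ML); exact: sys.2.
    + move=> v; move: unc1; rewrite (ltr_nat _ _ 1) ltnS leqn0 cards_eq0 => /eqP/setP/(_ v).
      by rewrite !inE /= => /negbT/forallPn[y]; rewrite negb_imply negbK => ?; exists y.
  rewrite cardsCs finset.setCK hT natrB; last by rewrite -hT max_card.
  have xMt : (#|x ord0 |: M|%SET <= 1 + t)%N by rewrite cardsU1 leq_add // leq_b1.
  have : #|x ord0 |: M|%SET%:R <= 1 + (1 + ln n%:R / alpha).
    apply: le_trans (_ : (1 + t)%N%:R <= _); first by rewrite ler_nat.
    by rewrite natrD lerD2l /t -natr1 addrC lerD2l.
  (* This turns the bound [2 + ln n / alpha] on the number of vertices in [x |: M] into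
     [2 * (ln n / alpha)]. *)
  have : 2 <= ln n%:R / alpha by rewrite ler_pdivlMr //; nra.
  by rewrite (_ : 2 / alpha * ln n%:R = 2 * (ln n%:R / alpha)); [lra|field; rewrite gt_eqF].
right; exists k.+2.
pose cov v y i := e v y && (c [set v; y]%SET == col i).
have Hcov v (d := #|[set y in L | [exists i, cov v y i]]%SET|) :
    (2 * #|T| * (4 * #|'I_k.+2| - 1) ^ d <= (4 * #|'I_k.+2|) ^ d)%N.
  have ad : a <= d%:R.
    apply: le_trans (usable v) _; rewrite ler_nat; apply: subset_leq_card.
    apply/fintype.subsetP => y; rewrite !inE => /and3P[-> ev /existsP[i ci]].
    by apply/existsP; exists i; rewrite /cov ev.
  rewrite card_ord hT; apply: (pred_expn_le (R := R)) => //.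
    by rewrite muln_gt0 /= -(ltr0n R).
  have kR : k.+2%:R <= r%:R :> R by rewrite ler_nat.
  rewrite natrM lnM ?posrE // natrM.
  have ln2n : ln 2 <= ln n%:R :> R by rewrite ler_ln ?posrE //; lra.
  have k0 : 0 < k.+2%:R :> R by rewrite ltr0n.
  rewrite ler_pdivlMr ?mulr_gt0 //; apply: le_trans ad; apply: le_trans aln.
  (* The left side is at most [8 * r * ln n], and [2 * r <= 1 / alpha] bounds this by
     [4 / alpha * ln n]. *)
  have r_alpha : 2 * r%:R <= alpha^-1.
    rewrite -[leRHS]mul1r ler_pdivlMr //; apply: le_trans alpha_er.
    rewrite [leRHS]mulrC ler_pM2r //; apply: le_trans (_ : 2 * (r`!)%:R <= _); first by lra.
    by rewrite ler_wpM2r //; lra.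
  nra.
have [|M [g [ML M2 Mg]]] := random_cover L cov _ Hcov; first by rewrite card_ord.
exists #|L :\: M|%SET; split; first by rewrite /= kr.
  by rewrite -hT; apply: (star_system_partition x col L M g).
(* [M] takes at most half of [L], and [#|L|] is at least [a + b], hence at least [alpha * n]. *)
have : (#|L| <= 2 * #|L :\: M|%SET)%N.
  by rewrite cardsD (finset.setIidPr ML); move: #|L| #|M| M2 => l m; clear; lia.
by rewrite -(ler_nat R) natrM -/a; lra.
Qed.
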